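(* Let $\mathcal J_i$ be a finite nonempty index set, $a_{ij}\in\mathbb R^d\setminus\{0\}$ and $b_{ij}\in\mathbb R$ for $j\in\mathcal J_i$. Let $\mathcal K_i\subseteq\mathcal J_i$ have $K$ elements, let $\tilde a_{i1},\dots,\tilde a_{iK}$ be the normals $a_{ij}$ with $j\in\mathcal K_i$, and let $b_1^{\mathrm{kept}},\dots,b_K^{\mathrm{kept}}$ be the corresponding offsets $b_{ij}$. Suppose there are $\lambda_{jk}\ge0$ with $a_{ij}=\sum_{k=1}^K\lambda_{jk}\tilde a_{ik}$ for every $j\in\mathcal J_i$. Let $v^{\mathrm{nom}}\in\mathbb R^d$ and set $$s_k:=\tilde a_{ik}^\top v^{\mathrm{nom}},\qquad d_j:=\sum_{k=1}^K\lambda_{jk}.$$ Then $d_j>0$ for every $j\in\mathcal J_i$, and the optimal value of the linear program $$\begin{aligned}\min_{\tilde b\in\mathbb R^K,\ \epsilon\in\mathbb R}\quad&\epsilon\\ \text{s.t.}\quad&\tilde b_k\le\tilde a_{ik}^\top v^{\mathrm{nom}}+\epsilon,&&k=1,\dots,K,\\&\sum_{k=1}^K\lambda_{jk}\tilde b_k\ge b_{ij},&&j\in\mathcal J_i,\\&\tilde b_k\ge b_k^{\mathrm{kept}},&&k=1,\dots,K,\end{aligned}$$ is $$\epsilon^\star=\max\Big\{\max_{1\le k\le K}\big(b_k^{\mathrm{kept}}-s_k\big),\ \max_{j\in\mathcal J_i}\frac{b_{ij}-\sum_{k=1}^K\lambda_{jk}s_k}{d_j}\Big\}.$$ One optimal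 offset vector is $\tilde b^\star=s+\epsilon^\star\mathbf 1$.
   Context: $\mathbf 1$ is the all-ones vector in $\mathbb R^K$ and $s=(s_1,\dots,s_K)$. In the application, $a_{ij}^\top u\ge b_{ij}$ are the tube-tightened safety halfspaces of an agent, and $b_k^{\mathrm{kept}}$ is the original offset of the $k$-th retained constraint. *)

(* Defs.v *)
From mathcomp Require Import all_boot all_order all_algebra.
Set Implicit Arguments.
Unset Strict Implicit.
Unset Printing Implicit Defensive.
Import Order.TTheory GRing.Theory Num.Theory.
Local Open Scope ring_scope.

(* The inner product u^T v, read off the 1 x 1 matrix u^T *m v. *)
Definition dotv (R : pzRingType) (n : nat) (u v : 'cV[R]_n) : R :=
  (u^T *m v) 0 0.

(* The maximum of F over a nonempty finite type I. The neutral element of the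
   iterated maximum is itself a value of F, so no bottom element of R is
   needed; if I is empty the result is the junk value 0. *)
Definition fmax (R : realDomainType) (I : finType) (F : I -> R) : R :=
  \big[Num.max/head 0 (codom F)]_(i : I) F i.

Lemma fmax_ge (R : realDomainType) (I : finType) (F : I -> R) (i : I) :
  F i <= fmax F.
Proof. exact: le_bigmax. Qed.

Lemma fmax_attained (R : realDomainType) (I : finType) (F : I -> R) :
  (0 < #|I|)%N -> exists i, fmax F = F i.
Proof.
move=> I0; have /codomP[i0 hd] : head 0 (codom F) \in codom F.
  by case E : (codom F) (size_codom F) => [|x s] /=;
    [move=> I00; rewrite -I00 in I0 | rewrite mem_head].
rewrite /fmax; elim/big_ind: _ => [|x y [i ->] [j ->]|i _].
- by exists i0.
- by rewrite /Num.max; case: ifP => _; [exists j | exists i].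
- by exists i.
Qed.

Definition is_minimizer (R : realDomainType) (X : Type)
    (feasible : X -> Prop) (obj : X -> R) (x : X) : Prop :=
  feasible x /\ forall y, feasible y -> obj x <= obj y.

(* The value of "min obj(x) subject to feasible x", attainment included. *)
Definition is_min_value (R : realDomainType) (X : Type)
    (feasible : X -> Prop) (obj : X -> R) (m : R) : Prop :=
  exists2 x, is_minimizer feasible obj x & obj x = m.

(* Constraints of the linear program in the variable x = (btilde, epsilon). *)
Definition lp_feasible (R : realFieldType) (n K : nat) (J : finType)
    (atil : 'I_K -> 'cV[R]_n) (bkept : 'I_K -> R) (b : J -> R)
    (lam : J -> 'I_K -> R) (v : 'cV[R]_n) (x : 'cV[R]_K * R) : Prop :=
  [/\ forall k, x.1 k 0 <= dotv (atil k) v + x.2,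
      forall j, \sum_(k < K) lam j k * x.1 k 0 >= b j
    & forall k, x.1 k 0 >= bkept k].

Definition lp_objective (R : realFieldType) (K : nat) (x : 'cV[R]_K * R) : R :=
  x.2.

(* Main.v *)
(** Since the weights are nonnegative, raising every offset to its upper bound
    [s_k + eps] preserves the lower-bound constraints. Hence [eps] is attainable
    iff [s + eps 1] is feasible, and since each [d_j] is positive this says that
    [eps] exceeds finitely many thresholds, whose maximum is [epsstar]. *)

Require Import Defs.
From mathcomp Require Import all_boot all_order all_algebra.
Set Implicit Arguments.
Unset Strict Implicit.
Unset Printing Implicit Defensive.
Import Order.TTheory GRing.Theory Num.Theory.
Local Open Scope ring_scope.

Lemma fmax_le (R : realDomainType) (I : finType) (F : I -> R) (x : R) :
  (0 < #|I|)%N -> (forall i, F i <= x) -> fmax F <= x.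
Proof. by move=> /(fmax_attained F)[i ->]. Qed.

(** Were the sum of the nonnegative [c i] zero, each [c i] would vanish, and the combination with
    it. *)
Lemma sum_scale_gt0 (R : realDomainType) (V : lmodType R) (I : finType)
    (c : I -> R) (w : I -> V) :
  (forall i, 0 <= c i) -> \sum_i c i *: w i != 0 -> 0 < \sum_i c i.
Proof.
move=> c_ge0; rewrite lt_def sumr_ge0 // andbT; apply: contraNneq => sum0.
by apply/eqP/big1 => i _; rewrite (psumr_eq0P (fun i _ => c_ge0 i) sum0) ?scale0r.
Qed.

(** Makes the [j]-th weighted constraint at [s + e 1] affine in [e] with slope [d j]. *)
Lemma sum_mul_shift (R : pzRingType) (I : finType) (c s : I -> R) (e : R) :
  \sum_i c i * (s i + e) = \sum_i c i * s i + (\sum_i c i) * e.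
Proof.
by under eq_bigr do rewrite mulrDr; rewrite big_split mulr_suml.
Qed.

Theorem mainTheorem7 (R : realFieldType) (n : nat) (J : finType)
    (J_nonempty : (0 < #|J|)%N)
    (a : J -> 'cV[R]_n) (b : J -> R) (a_neq0 : forall j, a j != 0)
    (Kset : {set J}) (K : nat) (kappa : 'I_K -> J)
    (kappa_inj : injective kappa)
    (kappa_img : [set kappa k | k : 'I_K] = Kset)
    (lam : J -> 'I_K -> R) (lam_ge0 : forall j k, 0 <= lam j k)
    (vnom : 'cV[R]_n) :
  let atil := fun k : 'I_K => a (kappa k) in
  let bkept := fun k : 'I_K => b (kappa k) in
  (forall j, a j = \sum_(k < K) lam j k *: atil k) ->
  let s : 'cV[R]_K := \col_k dotv (atil k) vnom in
  let d := fun j : J => \sum_(k < K) lam j k in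
  let epsstar :=
    Num.max (fmax (fun k : 'I_K => bkept k - s k 0))
            (fmax (fun j : J => (b j - \sum_(k < K) lam j k * s k 0) / d j)) in
  let bstar : 'cV[R]_K := s + epsstar *: const_mx 1 in
  let feasible := lp_feasible atil bkept b lam vnom in
  [/\ forall j, 0 < d j,
      is_min_value feasible (@lp_objective R K) epsstar
    & is_minimizer feasible (@lp_objective R K) (bstar, epsstar)].
Proof.
move=> atil bkept a_comb s d epsstar bstar feasible.
have d_gt0 j : 0 < d j.
  by apply: (@sum_scale_gt0 _ _ _ _ atil) => //; rewrite -a_comb.
(* For [K] zero, [d j] would be an empty sum. This keeps the junk value 0 of [fmax] out of the lower
   bound on [e]. *)
have K_gt0 : (0 < #|'I_K|)%N.
  have /card_gt0P[j _] := J_nonempty.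
  rewrite card_ord lt0n; apply: contraTneq (d_gt0 j) => K0.
  by rewrite /d big1 ?ltxx // => k; have := ltn_ord k; rewrite [X in (_ < X)%N]K0.
have bstarE k : bstar k 0 = s k 0 + epsstar by rewrite !mxE mulr1.
have opt : is_minimizer feasible (@lp_objective R K) (bstar, epsstar).
  split=> [|[y e] [/= le_y ge_b ge_kept]].
    (* The upper bounds are tight at [bstar]; every other constraint, after division by [d j] for
       the weighted ones, is a threshold below [epsstar]. *)
    split=> [k|j|k] /=.
    - by rewrite bstarE mxE.
    - under eq_bigr do rewrite bstarE.
      rewrite sum_mul_shift -lerBlDl mulrC -(ler_pdivrMr _ _ (d_gt0 j)).
      by rewrite le_max (fmax_ge (fun j => _ / d j)) orbT.
    - rewrite bstarE -lerBlDl le_max.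
      by rewrite (fmax_ge (fun k => bkept k - s k 0)).
  have le_s k : y k 0 <= s k 0 + e by rewrite [s k 0]mxE.
  rewrite /lp_objective /= ge_max; apply/andP; split.
    by apply: fmax_le => // k; rewrite lerBlDl (le_trans (ge_kept k)).
  apply: fmax_le => // j.
  rewrite (ler_pdivrMr _ _ (d_gt0 j)) lerBlDl mulrC -sum_mul_shift.
  (* Nonnegative weights allow raising [y] to [s + e 1] without decreasing the sum. *)
  by apply: le_trans (ge_b j) _; apply: ler_sum => k _; apply: ler_wpM2l.
by split=> //; exists (bstar, epsstar).
Qed.
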